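(* Let $d\geq 1$. For every nonzero $p\in P_{d,2}$, \[ \frac{\|p\|_\infty}{\|p\|_B}\;\geq\;\frac{\|\mathrm{Ch}_{d,2}\|_\infty}{\|\mathrm{Ch}_{d,2}\|_B}\;=\;\frac{1}{\sqrt{2^{d-1}}}. \] Moreover: \begin{itemize} \item when $d=1$, equality holds for every nonzero $p\in P_{1,2}$; \item when $d=2$, equality holds if and only if $p=\pm g^*(x_1^2+x_2^2)$ or $p=g^*(x_1^2-x_2^2)$ for some $g\in CO(2)$; \item when $d\geq 3$, equality holds if and only if $p=g^*\mathrm{Ch}_{d,2}$ for some $g\in CO(2)$. \end{itemize}
   Context: $P_{d,n}$ denotes the real vector space of homogeneous polynomials (forms) of degree $d$ in $n$ real variables. For $p\in P_{d,n}$, the uniform norm is $\|p\|_\infty=\max_{\|x\|=1}|p(x)|$, where $\|\cdot\|$ is the Euclidean norm on $\mathbb{R}^n$. Writing $p(x)=\sum_{|\alpha|=d}c_\alpha x^\alpha$ in the monomial basis, the Bombieri norm is \[ \|p\|_B=\Big(\sum_{|\alpha|=d}\binom{d}{\alpha}^{-1}|c_\alpha|^2\Big)^{1/2},\qquad \binom{d}{\alpha}=\frac{d!}{\alpha_1!\cdots\alpha_n!}. \] The conformal orthogonal group is $CO(n)=\mathbb{R}_{>0}\times O(n)$. It acts on $P_{d,n}$ by $(g^*p)(x)=s\,p(\rho^{-1}x)$ for $g=(s,\rho)$. The binary Chebyshev form of degree $d$ is \[ \mathrm{Ch}_{d,2}(x_1,x_2)=\frac{(x_1+ix_2)^d+(x_1-ix_2)^d}{2}=\sum_{k=0}^{\lfloor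 d/2\rfloor}\binom{d}{2k}(-1)^kx_1^{d-2k}x_2^{2k}. \] *)

(* Defs.v *)
From Stdlib Require Import Reals Lra Lia.
Open Scope R_scope.

(* A binary form p in P_{d,2} is given by its coefficient sequence c:
   p(x1,x2) = sum_{k=0}^{d} c k * x1^(d-k) * x2^k.
   Coefficients with index > d are ignored. *)
Definition form := nat -> R.

Definition feval (d : nat) (c : form) (x1 x2 : R) : R :=
  sum_f_R0 (fun k => c k * x1 ^ (d - k) * x2 ^ k) d.

Definition form_nonzero (d : nat) (c : form) : Prop :=
  exists k, (k <= d)%nat /\ c k <> 0.

(* Bombieri norm: multinomial binom(d; d-k, k) = C d k. *)
Definition bombieri (d : nat) (c : form) : R :=
  sqrt (sum_f_R0 (fun k => (c k) ^ 2 / C d k) d).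

Definition IsUnifNorm (d : nat) (c : form) (m : R) : Prop :=
  (forall x1 x2, x1 ^ 2 + x2 ^ 2 = 1 -> Rabs (feval d c x1 x2) <= m) /\
  (exists x1 x2, x1 ^ 2 + x2 ^ 2 = 1 /\ Rabs (feval d c x1 x2) = m).

Definition cheb (d : nat) : form :=
  fun k => if Nat.even k then (-1) ^ (Nat.div2 k) * C d k else 0.

Definition sumsq : form := fun k => match k with 0%nat => 1 | 2%nat => 1 | _ => 0 end.
Definition negsumsq : form := fun k => - sumsq k.
Definition diffsq : form := fun k => match k with 0%nat => 1 | 2%nat => -1 | _ => 0 end.

(* rho = [[a, b], [c, e]] is in O(2): rho^T rho = I. *)
Definition orth2 (a b c e : R) : Prop :=
  a * a + c * c = 1 /\ b * b + e * e = 1 /\ a * b + c * e = 0.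

(* p = g^* q for some g = (s, rho) in CO(2), where (g^* q)(x) = s q(rho^{-1} x)
   and rho^{-1} = rho^T, so rho^{-1}(x1,x2) = (a x1 + c x2, b x1 + e x2). *)
Definition CO2_pullback (d : nat) (p q : form) : Prop :=
  exists s a b c e, 0 < s /\ orth2 a b c e /\
    forall x1 x2, feval d p x1 x2 = s * feval d q (a * x1 + c * x2) (b * x1 + e * x2).

(* Main.v *)
(* In the coordinates z = x1 + i x2, w = x1 - i x2 write p = sum_j a_j z^(d-j) w^j
   with a_(d-j) conjugate to a_j.  Up to the factor sqrt 2 this change of variables
   is unitary, so |p|_B^2 = 2^d sum_j |a_j|^2 / C(d,j).  Sampling p at the d points
   zeta omega^(-k) of the unit circle, where omega is a primitive 2d-th root of unity
   and a_0 zeta^d = |a_0|, discrete Parseval gives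
     4 |a_0|^2 + sum_(0<j<d) |a_j|^2 = mean of p^2 <= |p|_oo^2,
   and 2 / C(d,j) <= 1 for 0 < j < d yields |p|_B^2 <= 2^(d-1) |p|_oo^2.  If d >= 3
   these weights are < 1, so equality forces a_j = 0 for 0 < j < d, that is
   p = 2 Re (a_0 z^d), a rotated Chebyshev form.  If d = 2, equality forces
   a_0 a_1 = 0. *)
Require Import Defs.
From Stdlib Require Import Reals Lia.
From mathcomp Require all_boot all_order all_algebra all_solvable separable cyclotomic.
From mathcomp Require ring complex Rstruct.
Open Scope R_scope.

(** Fixed here so that its operations are those of the Stdlib reals; [n] is the degree minus one. *)
Definition extremal_ratio (n : nat) : R := 1 / sqrt (2 ^ n).

(* The module confines the MathComp notations, which would change the parsing of
   the final statement. *)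
Module BinaryForms.
Import all_boot all_order all_algebra all_solvable separable cyclotomic.
Import ring complex Rstruct.
Set Implicit Arguments.
Unset Strict Implicit.
Unset Printing Implicit Defensive.
Import Order.TTheory GRing.Theory Num.Theory.
Local Open Scope ring_scope.

(** * Binary forms over a ring *)

(** The analogue of [feval] over any ring, so that a real form can also be evaluated at complex
    points. *)
Definition hform (K : nzRingType) (d : nat) (c : nat -> K) (x y : K) : K :=
  \sum_(k < d.+1) c k * x ^+ (d - k) * y ^+ k.

(** At [x = 1] the difference is a polynomial in [y] of degree at most [d] that vanishes at the
    [d + 1] points [0, ..., d], distinct in characteristic zero. *)
Lemma hform_inj (K : numDomainType) d (a b : nat -> K) :
  (forall n : nat, hform d a 1 n%:R = hform d b 1 n%:R) ->
  forall k, (k <= d)%N -> a k = b k.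
Proof.
move=> eqab k led.
pose p := \poly_(j < d.+1) (a j - b j).
suff p0 : p = 0.
  have := coef_poly d.+1 (fun j => a j - b j) k.
  by rewrite -/p p0 coef0 ltnS led => /esym/eqP; rewrite subr_eq0 => /eqP.
apply: (@roots_geq_poly_eq0 _ p [seq n%:R | n <- iota 0 d.+1]).
- apply/allP => _ /mapP[n _ ->]; apply/rootP; rewrite horner_poly.
  have := eqab n; rewrite /hform => /eqP; rewrite -subr_eq0 -sumrB => /eqP {2}<-.
  by apply: eq_bigr => j _; rewrite !expr1n !mulr1 mulrBl.
- by rewrite map_inj_uniq ?iota_uniq //; apply: mulrIn; rewrite oner_neq0.
- by rewrite size_map size_iota size_poly.
Qed.

Lemma eq_hform (K : nzRingType) d (a b : nat -> K) :
  (forall k, (k <= d)%N -> a k = b k) -> hform d a =2 hform d b.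
Proof. by move=> eqab x y; apply: eq_bigr => k _; rewrite eqab // -ltnS. Qed.

Lemma hform_rev (K : comNzRingType) d (a : nat -> K) x y :
  hform d (fun k => a (d - k)%N) x y = hform d a y x.
Proof.
rewrite /hform (reindex_inj rev_ord_inj) /=; apply: eq_bigr => k _.
have kd : (k <= d)%N by rewrite -ltnS.
by rewrite subSS subKn // mulrAC.
Qed.

Lemma hform_map (K L : nzRingType) (f : {rmorphism K -> L}) d c x y :
  f (hform d c x y) = hform d (f \o c) (f x) (f y).
Proof.
by rewrite /hform rmorph_sum; apply: eq_bigr => k _; rewrite !rmorphM !rmorphXn.
Qed.

Lemma hform_mul_linear (K : comNzRingType) d (a : nat -> K) (u v : K) :
  exists b, forall x y, (u * x + v * y) * hform d a x y = hform d.+1 b x y.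
Proof.
(* [hform d] ignores coefficients beyond [d], but degree [d + 1] would read the one at [d + 1];
   truncation sets it to zero. *)
pose a' k := if (k <= d)%N then a k else 0.
exists (fun k => u * a' k + v * (if k is k'.+1 then a' k' else 0)) => x y.
rewrite /hform mulrDl !mulr_sumr.
under [RHS]eq_bigr => k _ do rewrite !mulrDl.
rewrite big_split /=; congr (_ + _).
  rewrite [RHS]big_ord_recr /= /a' ltnn mulr0 !mul0r addr0.
  apply: eq_bigr => k _ /=; have kd : (k <= d)%N by rewrite -ltnS.
  by rewrite kd subSn // exprS; ring.
rewrite [RHS]big_ord_recl /= mulr0 !mul0r add0r.
apply: eq_bigr => k _; have kd : (k <= d)%N by rewrite -ltnS.
by rewrite /a' /= /bump /= add1n kd subSS exprS; ring.
Qed.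

(** Each substituted monomial is a product of [d] linear forms, built up by [hform_mul_linear]; the
    coefficients then add up linearly. *)
Lemma hform_subst (K : comNzRingType) d (c : nat -> K) (u v u' v' : K) :
  exists a, forall x y,
    hform d c (u * x + v * y) (u' * x + v' * y) = hform d a x y.
Proof.
have mon m n : exists a, forall x y,
    (u * x + v * y) ^+ m * (u' * x + v' * y) ^+ n = hform (m + n) a x y.
  elim: m => [|m [a IH]].
    elim: n => [|n [a IH]].
      by exists (fun=> 1) => x y; rewrite /hform big_ord1 !expr0 !mulr1.
    have [b Hb] := hform_mul_linear n a u' v'; exists b => x y.
    by rewrite add0n -Hb -IH exprS; ring.
  have [b Hb] := hform_mul_linear (m + n) a u v; exists b => x y.
  by rewrite addSn -Hb -IH exprS; ring.
have /fin_all_exists[b Hb] (k : 'I_d.+1) : exists a, forall x y,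
    (u * x + v * y) ^+ (d - k) * (u' * x + v' * y) ^+ k = hform d a x y.
  by have := mon (d - k)%N k; rewrite subnK // -ltnS.
exists (fun j => \sum_(k < d.+1) c k * b k j) => x y.
rewrite /hform.
under [RHS]eq_bigr => j _ do rewrite !mulr_suml.
rewrite exchange_big; apply: eq_bigr => k _.
rewrite -mulrA Hb /hform mulr_sumr; apply: eq_bigr => j _; ring.
Qed.

(** * Isotropic coordinates *)

Section Complex.
Variable C : numClosedFieldType.
Implicit Types (a c : nat -> C) (x y z w : C).

(* The [a j] are the coefficients of the form in the isotropic coordinates
   [z = x + i y], [w = x - i y]. *)
Definition isotropic_coords d c a :=
  forall x y, hform d c x y = hform d a (x + 'i * y) (x - 'i * y).

(** Both sides are forms in [x], [y], so by [hform_inj] agreement at the points [(1, n)] is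
    enough. *)
Lemma isotropic_coordsP d c a :
  (forall n : nat, hform d c 1 n%:R = hform d a (1 + 'i * n%:R) (1 - 'i * n%:R)) ->
  isotropic_coords d c a.
Proof.
move=> eqca x y.
have [b Hb] := hform_subst d a 1 'i 1 (- 'i).
have {}Hb u v : hform d a (u + 'i * v) (u - 'i * v) = hform d b u v.
  by rewrite -Hb !mul1r mulNr.
by rewrite Hb; apply: eq_hform; apply: hform_inj => n; rewrite -Hb.
Qed.

Lemma isotropic_inv d c a z w : isotropic_coords d c a ->
  hform d a z w = hform d c ((z + w) / 2) ((z - w) / (2 * 'i)).
Proof.
by move->; congr (hform d a _ _); field; rewrite ?neq0Ci ?pnatr_eq0.
Qed.

Lemma isotropic_coords_ex d c : exists a, isotropic_coords d c a.
Proof.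
have [a Ha] := hform_subst d c 2^-1 2^-1 (2 * 'i)^-1 (- (2 * 'i)^-1).
exists a => x y; rewrite -Ha; congr (hform d c _ _);
  by field; rewrite ?neq0Ci ?pnatr_eq0.
Qed.

(** For real [z] and [w], conjugation fixes [(z + w) / 2] and negates [(z - w) / (2 i)], which
    amounts to exchanging [z] and [w]; a form with real coefficients commutes with it. *)
Lemma isotropic_coords_conj d c a : isotropic_coords d c a ->
  (forall k, c k \is Num.real) ->
  forall j, (j <= d)%N -> a (d - j)%N = (a j)^*.
Proof.
move=> Hca creal; apply: (@hform_inj _ _ _ (fun j => (a j)^*)) => n.
rewrite hform_rev.
transitivity ((hform d a 1 n%:R)^*); last first.
  by rewrite hform_map rmorph1 rmorph_nat.
rewrite !(isotropic_inv _ _ Hca) hform_map.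
rewrite (@eq_hform _ d (_ \o c) c); last by move=> k _ /=; rewrite conj_Creal.
congr (hform d c _ _).
  by rewrite fmorph_div rmorphD rmorph1 !rmorph_nat addrC.
rewrite fmorph_div rmorphM rmorphB rmorph1 !rmorph_nat /= conjCi.
by field; rewrite neq0Ci.
Qed.

Lemma bin_neq0 d (k : 'I_d.+1) : 'C(d, k)%:R != 0 :> C.
Proof. by rewrite pnatr_eq0 -lt0n bin_gt0 -ltnS. Qed.

(* The form [(u . x) ^ d] reproduces the value at [u] under the bilinear Bombieri
   product.  Expanding [(u z + v w) ^ d] for generic [u], [v] therefore gives the
   product of [c] with each monomial [z ^ (d - j) w ^ j]. *)
Lemma bombieri_isotropic d c a : isotropic_coords d c a ->
  \sum_(k < d.+1) c k ^+ 2 / 'C(d, k)%:R =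
  2 ^+ d * \sum_(j < d.+1) a j * a (d - j)%N / 'C(d, j)%:R.
Proof.
move=> Hca.
have /fin_all_exists[e He] (j : 'I_d.+1) : exists e, forall x y,
    (x + 'i * y) ^+ (d - j) * (x - 'i * y) ^+ j = hform d e x y.
  have [e He] := hform_subst d (fun k => (k == j)%:R) 1 'i 1 (- 'i : C).
  exists e => x y; rewrite -He /hform (bigD1 j) //= big1 => [|k neq_kj].
    by rewrite eqxx !mul1r mulNr addr0.
  by rewrite (inj_eq val_inj) (negbTE neq_kj) !mul0r.
have Hc k : (k <= d)%N -> c k = \sum_(j < d.+1) a j * e j k.
  apply: (@hform_inj _ _ _ (fun k => \sum_(j < d.+1) a j * e j k)) => n.
  rewrite Hca /hform.
  under [RHS]eq_bigr => j _ do rewrite !mulr_suml.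
  rewrite exchange_big; apply: eq_bigr => j _.
  by rewrite -mulrA He /hform mulr_sumr; apply: eq_bigr => i _; ring.
(* Generating function of the [e j k]: the power [d] of [u z + v w = (u + v) x + i (u - v) y] is
   expanded in both ways and the coefficients in [x], [y] are compared. *)
have Hbin u v k : (k <= d)%N ->
    \sum_(j < d.+1) 'C(d, j)%:R * u ^+ (d - j) * v ^+ j * e j k =
    'C(d, k)%:R * (u + v) ^+ (d - k) * ('i * (u - v)) ^+ k.
  apply: (@hform_inj _ _ (fun k => \sum_(j < d.+1) _)
           (fun k => 'C(d, k)%:R * (u + v) ^+ (d - k) * ('i * (u - v)) ^+ k)) => n.
  transitivity ((u * (1 + 'i * n%:R) + v * (1 - 'i * n%:R)) ^+ d).
    rewrite exprDn /hform.
    under eq_bigr => j _ do rewrite !mulr_suml.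
    rewrite exchange_big; apply: eq_bigr => j _.
    rewrite !exprMn -[in RHS]mulr_natl.
    transitivity ('C(d, j)%:R * u ^+ (d - j) * v ^+ j *
       ((1 + 'i * n%:R) ^+ (d - j) * (1 - 'i * n%:R) ^+ j)); last by ring.
    by rewrite He /hform mulr_sumr; apply: eq_bigr => i _; ring.
  have -> : u * (1 + 'i * n%:R) + v * (1 - 'i * n%:R) =
     (u + v) * 1 + 'i * (u - v) * n%:R by ring.
  rewrite exprDn /hform; apply: eq_bigr => j _.
  by rewrite !exprMn -mulr_natl; ring.
(* The bilinear Bombieri product of [c] with the monomial [z ^ (d - j) w ^ j]. *)
pose D j := \sum_(k < d.+1) c k * e (inord j) k / 'C(d, k)%:R.
have HD : forall j, (j <= d)%N -> 'C(d, j)%:R * D j = 2 ^+ d * a (d - j)%N.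
  suff HDuv u v : hform d (fun j => 'C(d, j)%:R * D j) u v =
      hform d (fun j => 2 ^+ d * a (d - j)%N) u v.
    by apply: hform_inj => n; apply: HDuv.
  transitivity (hform d c (u + v) ('i * (u - v))).
    rewrite /hform.
    transitivity (\sum_(k < d.+1) c k / 'C(d, k)%:R *
        \sum_(j < d.+1) 'C(d, j)%:R * u ^+ (d - j) * v ^+ j * e j k).
      under eq_bigr => j _ do rewrite /D mulr_sumr !mulr_suml.
      rewrite exchange_big; apply: eq_bigr => k _.
      by rewrite mulr_sumr; apply: eq_bigr => j _; rewrite inord_val; ring.
    apply: eq_bigr => k _; have kd : (k <= d)%N by rewrite -ltnS.
    rewrite Hbin; last exact: kd.
    by field; rewrite bin_neq0.
  rewrite Hca.
  (* The point [(u + v, i (u - v))] has isotropic coordinates [(2 v, 2 u)]: the exchange of [u] and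
     [v] turns index [j] into [d - j], and the doubling gives [2 ^ d]. *)
  have -> : u + v + 'i * ('i * (u - v)) = 2 * v.
    by rewrite mulrA -expr2 sqrCi; ring.
  have -> : u + v - 'i * ('i * (u - v)) = 2 * u.
    by rewrite mulrA -expr2 sqrCi; ring.
  rewrite -hform_rev /hform; apply: eq_bigr => j _.
  have jd : (j <= d)%N by rewrite -ltnS.
  have e2 : (2 : C) ^+ d = 2 ^+ (d - j) * 2 ^+ j by rewrite -exprD subnK.
    by rewrite !exprMn e2; ring.
transitivity (\sum_(j < d.+1) a j * D j).
  transitivity (\sum_(k < d.+1) \sum_(j < d.+1) c k * (a j * e j k) / 'C(d, k)%:R).
    apply: eq_bigr => k _; have kd : (k <= d)%N by rewrite -ltnS.
    by rewrite expr2 [X in _ * X / _](Hc _ kd) mulr_sumr mulr_suml.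
  rewrite exchange_big; apply: eq_bigr => j _.
  by rewrite /D mulr_sumr; apply: eq_bigr => k _; rewrite inord_val; ring.
rewrite mulr_sumr; apply: eq_bigr => j _.
apply: (mulfI (bin_neq0 j)).
have jd : (j <= d)%N by rewrite -ltnS.
rewrite mulrCA HD; last exact: jd.
by field; rewrite bin_neq0.
Qed.

End Complex.

(** * Sampling on the unit circle *)

Section Sampling.
Variable C : numClosedFieldType.
Implicit Types (a b : nat -> C) (z w : C).

Lemma prim_root_ex n : (0 < n)%N -> exists w : C, n.-primitive_root w.
Proof.
move=> n_gt0.
have [rs Drs] := closed_field_poly_normal ('X^n - 1 : {poly C}).
rewrite (monicP _) ?monicXnsubC // scale1r in Drs.
have: has n.-primitive_root rs; last by case/hasP=> w; exists w.
apply: has_prim_root => //.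
- by apply/allP=> w; rewrite -root_prod_XsubC -Drs.
- by rewrite -separable_prod_XsubC -Drs separable_Xn_sub_1 // pnatr_eq0 -lt0n.
- by rewrite -ltnS -(size_prod_XsubC rs id) -Drs size_XnsubC.
Qed.

Lemma norm_root1 n w : (0 < n)%N -> `|w ^+ n| = 1 -> `|w| = 1.
Proof. by move=> n0 /eqP; rewrite normrX pexpr_eq1 // => /eqP. Qed.

Lemma sum_prim_root n w m : n.-primitive_root w ->
  \sum_(k < n) w ^+ (m * k) = if (n %| m)%N then n%:R else 0.
Proof.
move=> pw; rewrite (prim_order_dvd pw).
have -> : \sum_(k < n) w ^+ (m * k) = \sum_(k < n) (w ^+ m) ^+ k.
  by apply: eq_bigr => k _; rewrite exprM.
case: eqP => [->|/eqP neq1].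
  by under eq_bigr => k _ do rewrite expr1n; rewrite sumr_const card_ord.
apply/eqP; rewrite -subr_eq0 in neq1; rewrite -(mulrI_eq0 _ (mulfI neq1)).
by rewrite -subrX1 -exprM mulnC exprM (prim_expr_order pw) expr1n subrr.
Qed.

(** Parseval without conjugates: after expanding the square, the sum over [k] keeps only the pairs
    with [j + l] divisible by [n]. The outer reduction modulo [n] pairs index 0 with itself. *)
Lemma sum_sqr_dft n w b : n.-primitive_root w ->
  \sum_(k < n) (\sum_(j < n) b j * w ^+ (j * k)) ^+ 2 =
  n%:R * \sum_(j < n) b j * b ((n - j) %% n)%N.
Proof.
move=> pw; have n_gt0 := prim_order_gt0 pw.
transitivity (\sum_(j < n) \sum_(l < n) b j * b l * \sum_(k < n) w ^+ ((j + l) * k)).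
  under eq_bigr => k _.
    rewrite expr2 mulr_suml.
    under eq_bigr => j _ do rewrite mulr_sumr.
    over.
  rewrite exchange_big; apply: eq_bigr => j _.
  rewrite exchange_big; apply: eq_bigr => l _.
  by rewrite mulr_sumr; apply: eq_bigr => k _; rewrite mulnDl exprD; ring.
rewrite mulr_sumr; apply: eq_bigr => j _.
pose j' := Ordinal (ltn_pmod (n - j) n_gt0).
have dvd_sum (l : 'I_n) : (n %| j + l)%N = (l == j').
  have jn : (j <= n)%N by apply: ltnW.
  rewrite -val_eqE /= -[X in X == _](modn_small (ltn_ord l)) -(eqn_modDl j).
  by rewrite subnKC // modnn.
under eq_bigr => l _ do rewrite (sum_prim_root _ pw) dvd_sum.
rewrite (bigD1 j') //= big1 => [|l /negbTE->]; last by rewrite mulr0.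
by rewrite eqxx addr0; ring.
Qed.

(* On these samples the frequencies [n.+1] and [- n.+1] coincide, hence the
   single square of [a 0 z ^ n.+1 + a n.+1 z ^- n.+1]. *)
Lemma sum_sqr_samples n a z w : (n.+1 * 2).-primitive_root w -> z != 0 ->
  \sum_(k < n.+1) hform n.+1 a (z * w ^- k) (z * w ^- k)^-1 ^+ 2 =
  n.+1%:R * ((a 0%N * z ^+ n.+1 + a n.+1 * z ^- n.+1) ^+ 2
             + \sum_(i < n) a i.+1 * a (n - i)%N).
Proof.
move=> pw z0.
have w0 : w != 0 by rewrite (prim_root_eq0 pw).
have pw2 : n.+1.-primitive_root (w ^+ 2).
  by rewrite -[2%N](mulKn 2 (ltn0Sn n)) (dvdn_prim_root pw) // dvdn_mulr.
pose b j := if j is i.+1 then a i.+1 * z ^+ (n - i) * z ^- i.+1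
            else a 0%N * z ^+ n.+1 + a n.+1 * z ^- n.+1.
transitivity (\sum_(k < n.+1) (\sum_(j < n.+1) b j * (w ^+ 2) ^+ (j * k)) ^+ 2).
  apply: eq_bigr => k _.
  set wk := w ^+ k; have wk0 : wk != 0 by rewrite expf_neq0.
  (* The factor [wk ^- n.+1] is a sign, so it can be moved in and out of the square; pulling it out
     of the form leaves only powers of [w ^ 2]. *)
  have wk2 : (wk ^- n.+1) ^+ 2 = 1.
    by rewrite exprVn /wk -!exprM -mulnA mulnC exprM (prim_expr_order pw) expr1n invr1.
  have w2 j : (w ^+ 2) ^+ (j * k) = wk ^+ j * wk ^+ j.
    by rewrite /wk -!exprM -exprD; congr (_ ^+ _); ring.
  rewrite -[RHS]mul1r -wk2 -exprMn; congr (_ ^+ 2).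
  have tV : (z / wk)^-1 = wk / z by rewrite invfM invrK mulrC.
  rewrite /hform tV big_ord_recr big_ord_recl /= [in RHS]big_ord_recl.
  rewrite mulrDr mulr_sumr addrAC; congr (_ + _).
    have wkn : wk ^+ n.+1 * wk ^+ n.+1 = 1.
      by apply: invr_inj; rewrite invfM invr1 -expr2 -wk2.
    rewrite /b /= mul0n subn0 subnn !expr0 !mulr1 mulrDr !expr_div_n.
    congr (_ + _); first by ring.
    rewrite -[RHS]mulr1 -wkn; field.
    by rewrite !expf_neq0.
  apply: eq_bigr => i _; rewrite /b /= /bump /= add1n w2 subSS.
  have -> : n.+1 = (n - i + i.+1)%N by rewrite addnS subnK // ltnW.
  rewrite add0n exprD !expr_div_n; field.
  by rewrite !expf_neq0.
rewrite (sum_sqr_dft _ pw2) big_ord_recl /= subn0 modnn /= -expr2.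
(* Index [i + 1] is paired with [n - i], and their powers of [z] cancel. *)
congr (_ * (_ + _)); apply: eq_bigr => i _.
have ni : (i < n)%N by [].
rewrite /= /bump /= add1n subSS modn_small; last by rewrite ltnS leq_subr.
rewrite -(subnSK ni) /= (subnSK ni).
have -> : (n - (n - i.+1) = i.+1)%N by rewrite subKn.
have e1 : z ^+ (n - i) = z ^+ (n - i.+1).+1 by rewrite subnSK.
rewrite e1; field.
by rewrite !expf_neq0.
Qed.

(* Choosing [z] so that [a 0 * z ^ n.+1 >= 0] makes that square maximal. *)
Lemma sample_bound n a (M : C) : (forall j, (j <= n.+1)%N -> a (n.+1 - j)%N = (a j)^*) ->
  (forall z, `|z| = 1 -> `|hform n.+1 a z z^*| <= M) ->
  4 * `|a 0%N| ^+ 2 + \sum_(i < n) `|a i.+1| ^+ 2 <= M ^+ 2.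
Proof.
move=> herm bound.
have [w pw] := @prim_root_ex (n.+1 * 2) isT.
have w1 : `|w| = 1.
  by apply: (@norm_root1 (n.+1 * 2)) => //; rewrite (prim_expr_order pw) normr1.
have [z z1 Hz] : exists2 z : C, `|z| = 1 & a 0%N * z ^+ n.+1 = `|a 0%N|.
  have [a00|a0] := eqVneq (a 0%N) 0.
    by exists 1; rewrite ?normr1 // a00 mul0r normr0.
  exists (n.+1.-root (`|a 0%N| / a 0%N)).
    apply: (@norm_root1 n.+1) => //.
    by rewrite rootCK // normf_div normr_id divff // normr_eq0.
  by rewrite rootCK // mulrC divfK.
have norm1V (u : C) : `|u| = 1 -> u^-1 = u^*.
  by move=> u1; rewrite invC_norm u1 expr1n invr1 mul1r.
have z0 : z != 0 by rewrite -normr_eq0 z1 oner_neq0.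
have Hz' : a n.+1 * z ^- n.+1 = `|a 0%N|.
  by rewrite -exprVn norm1V // -{1}(subn0 n.+1) herm // -rmorphXn -rmorphM Hz /= conj_normC.
have := sum_sqr_samples a pw z0.
rewrite Hz Hz' => Hs.
have -> : 4 * `|a 0%N| ^+ 2 = (`|a 0%N| + `|a 0%N|) ^+ 2 by ring.
have -> : \sum_(i < n) `|a i.+1| ^+ 2 = \sum_(i < n) a i.+1 * a (n - i)%N.
  by apply: eq_bigr => i _; rewrite normCK -herm // ltnS ltnW.
rewrite -(ler_pM2l (_ : 0 < n.+1%:R)) ?ltr0Sn // -Hs.
have -> : n.+1%:R * M ^+ 2 = \sum_(k < n.+1) M ^+ 2.
  by rewrite sumr_const card_ord mulr_natl.
apply: ler_sum => k _.
have u1 : `|z * w ^- k| = 1 by rewrite normrM normfV normrX z1 w1 expr1n invr1 mulr1.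
rewrite (norm1V _ u1); have := bound _ u1; move: (z * _) => u.
have -> : hform n.+1 a u u^* ^+ 2 = `|hform n.+1 a u u^*| ^+ 2.
  rewrite normCK hform_map /= conjCK expr2; congr (_ * _).
  by rewrite -hform_rev; apply: eq_hform => j jn; rewrite herm.
by move=> le_M; rewrite lerXn2r // nnegrE ?normr_ge0 //; apply: le_trans le_M.
Qed.
End Sampling.

(** * Chebyshev forms and real forms *)

Definition hcheb (K : nzRingType) (d k : nat) : K :=
  if odd k then 0 else (-1) ^+ k./2 * 'C(d, k)%:R.

Lemma hcheb_map (K L : nzRingType) (f : {rmorphism K -> L}) d k :
  f (hcheb K d k) = hcheb L d k.
Proof.
rewrite /hcheb; case: ifP => _; first by rewrite rmorph0.
by rewrite rmorphM rmorphXn rmorphN1 rmorph_nat.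
Qed.

(** Only even powers of [y] occur. This symmetry later replaces reflections by rotations. *)
Lemma hform_chebN (K : comNzRingType) d (x y : K) :
  hform d (hcheb K d) x (- y) = hform d (hcheb K d) x y.
Proof.
apply: eq_bigr => k _; rewrite /hcheb; case: ifP => [_|/negbT evk].
  by rewrite !mul0r.
by rewrite (exprNn y) -[(-1) ^+ k]signr_odd (negbTE evk) mul1r.
Qed.

Section ComplexForms.
Variable C : numClosedFieldType.
Implicit Types (a c : nat -> C).

(** In the two binomial expansions the odd powers of [i y] cancel and the even ones double. *)
Lemma hform_cheb d (x y : C) :
  hform d (hcheb C d) x y = ((x + 'i * y) ^+ d + (x - 'i * y) ^+ d) / 2.
Proof.
rewrite !exprDn -big_split mulr_suml; apply: eq_bigr => k _ /=.
have ik : ('i : C) ^+ k = 'i ^+ odd k * (-1) ^+ k./2.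
  by rewrite -sqrCi -exprM mul2n -exprD odd_double_half.
have Nik : (- ('i : C)) ^+ k = (-1) ^+ odd k * 'i ^+ k by rewrite signr_odd -exprNn.
rewrite /hcheb -mulNr !exprMn Nik ik -mulrnDl -[X in X / _]mulr_natl.
by case: (odd k) => /=; rewrite ?expr0 ?expr1; field.
Qed.

Lemma hform_ends n a z w : (forall i, (i < n)%N -> a i.+1 = 0) ->
  hform n.+1 a z w = a 0%N * z ^+ n.+1 + a n.+1 * w ^+ n.+1.
Proof.
move=> mid0; rewrite /hform big_ord_recr big_ord_recl /= big1 => [|i _].
  by rewrite addr0 subn0 subnn !expr0 !mulr1.
by rewrite mid0 ?mul0r.
Qed.

(** The two end terms are equal with binomial weight 1. After doubling they give the same
    [4 |a_0|^2] as in [sample_bound], so only the middle weights remain to be compared. *)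
Lemma bombieri_herm n c a : isotropic_coords n.+1 c a ->
  (forall j, (j <= n.+1)%N -> a (n.+1 - j)%N = (a j)^*) ->
  2 * (\sum_(k < n.+2) c k ^+ 2 / 'C(n.+1, k)%:R) =
  2 ^+ n.+1 * (4 * `|a 0%N| ^+ 2 +
    \sum_(i < n) 2 / 'C(n.+1, i.+1)%:R * `|a i.+1| ^+ 2).
Proof.
move=> Hca herm; rewrite (bombieri_isotropic Hca) mulrCA; congr (_ * _).
have sqa j : (j <= n.+1)%N -> a j * a (n.+1 - j)%N = `|a j| ^+ 2.
  by move=> jn; rewrite herm // normCK.
have sqa' : a n.+1 * a 0%N = `|a 0%N| ^+ 2.
  by rewrite -{1}(subn0 n.+1) herm // normCK mulrC.
rewrite big_ord_recr big_ord_recl /= subnn sqa' sqa // bin0 binn !mulrDr.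
rewrite addrAC; congr (_ + _); first by field.
rewrite mulr_sumr; apply: eq_bigr => i _.
by rewrite /= /bump /= add1n sqa ?ltnS 1?ltnW //; ring.
Qed.

End ComplexForms.

Section RealForms.
Variable R : rcfType.
Implicit Types (c : nat -> R) (x y : R).
Local Notation C := R[i].
Local Notation "x %:C" := (real_complex R x) (format "x %:C").

Definition bombieri2 d c := \sum_(k < d.+1) c k ^+ 2 / 'C(d, k)%:R.

Definition pt x y : C := x%:C + 'i * y%:C.

Lemma ptP (z : C) : z = pt (complex.Re z) (complex.Im z).
Proof. by rewrite /pt -complexiE -complexE. Qed.

Lemma conj_pt x y : (pt x y)^* = x%:C - 'i * y%:C.
Proof.
have realC (r : R) : (r%:C)^* = r%:C.
  by rewrite conj_Creal //; apply/complex_realP; exists r.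
by rewrite /pt rmorphD rmorphM /= conjCi !realC mulNr.
Qed.

Lemma norm_pt x y : `|pt x y| ^+ 2 = (x ^+ 2 + y ^+ 2)%:C.
Proof.
rewrite normCK conj_pt /pt rmorphD !rmorphXn /=.
transitivity (x%:C ^+ 2 - 'i ^+ 2 * y%:C ^+ 2); first by ring.
by rewrite sqrCi; ring.
Qed.

Lemma norm_pt1 x y : (`|pt x y| == 1) = (x ^+ 2 + y ^+ 2 == 1).
Proof.
rewrite -(inj_eq (@complexI R)) rmorph1 -norm_pt.
by rewrite -(@pexpr_eq1 _ _ 2).
Qed.

Lemma ptM x y x' y' : pt x y * pt x' y' = pt (x * x' - y * y') (y * x' + x * y').
Proof.
rewrite /pt rmorphB rmorphD !rmorphM /=.
transitivity (x%:C * x'%:C + 'i ^+ 2 * (y%:C * y'%:C) +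
  'i * (y%:C * x'%:C + x%:C * y'%:C)); first by ring.
by rewrite sqrCi; ring.
Qed.

Lemma hform_realC d c x y :
  (hform d c x y)%:C = hform d (fun k => (c k)%:C) x%:C y%:C.
Proof. exact: hform_map. Qed.

Definition coords d c (a : nat -> C) :=
  isotropic_coords d (fun k => (c k)%:C) a /\
  (forall j, (j <= d)%N -> a (d - j)%N = (a j)^*).

Lemma coords_ex d c : exists a, coords d c a.
Proof.
have [a Ha] := isotropic_coords_ex d (fun k => (c k)%:C).
exists a; split=> //; apply: (isotropic_coords_conj Ha) => k.
by apply/complex_realP; exists (c k).
Qed.

Lemma coords_pt d c a x y : coords d c a ->
  (hform d c x y)%:C = hform d a (pt x y) (pt x y)^*.
Proof. by move=> [Ha _]; rewrite hform_realC Ha conj_pt. Qed.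

Lemma bombieri2C n c a : coords n.+1 c a ->
  2 * (bombieri2 n.+1 c)%:C =
  2 ^+ n.+1 * (4 * `|a 0%N| ^+ 2 +
    \sum_(i < n) 2 / 'C(n.+1, i.+1)%:R * `|a i.+1| ^+ 2).
Proof.
move=> [Ha herm]; rewrite -(bombieri_herm Ha herm); congr (_ * _).
rewrite rmorph_sum; apply: eq_bigr => k _.
by rewrite fmorph_div rmorphXn rmorph_nat.
Qed.

Lemma coords_bound n c a (M : R) : coords n.+1 c a ->
  (forall x y, x ^+ 2 + y ^+ 2 = 1 -> `|hform n.+1 c x y| <= M) ->
  4 * `|a 0%N| ^+ 2 + \sum_(i < n) `|a i.+1| ^+ 2 <= M%:C ^+ 2.
Proof.
move=> Ha bound; apply: sample_bound => [|z z1]; first by case: Ha.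
rewrite (ptP z) -(coords_pt _ _ Ha) in z1 *.
have /bound le_M : complex.Re z ^+ 2 + complex.Im z ^+ 2 = 1.
  by apply/eqP; rewrite -norm_pt1 z1.
by rewrite normc_def /= expr0n addr0 sqrtr_sqr lecR.
Qed.

(** * Binomial weights and the norm inequality *)

Lemma bin_ge2 n (i : 'I_n) : (2 <= 'C(n.+1, i.+1))%N.
Proof.
rewrite binS; apply: (@leq_add 1 1); rewrite bin_gt0 //.
exact: ltnW.
Qed.

Lemma bin_ratio_le1 n (i : 'I_n) : 2 / 'C(n.+1, i.+1)%:R <= 1 :> C.
Proof.
have b2 := bin_ge2 i.
by rewrite ler_pdivrMr ?mul1r ?ler_nat // ltr0n (leq_trans _ b2).
Qed.

Lemma mid_le n (a : nat -> C) :
  \sum_(i < n) 2 / 'C(n.+1, i.+1)%:R * `|a i.+1| ^+ 2 <= \sum_(i < n) `|a i.+1| ^+ 2.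
Proof.
apply: ler_sum => i _; rewrite ler_piMl ?exprn_ge0 //; exact: bin_ratio_le1.
Qed.

Lemma bombieri2_le n c (M : R) :
  (forall x y, x ^+ 2 + y ^+ 2 = 1 -> `|hform n.+1 c x y| <= M) ->
  bombieri2 n.+1 c <= 2 ^+ n * M ^+ 2.
Proof.
move=> bound; have [a Ha] := coords_ex n.+1 c.
rewrite -lecR -(ler_pM2l (_ : 0 < 2)) ?ltr0Sn // (bombieri2C Ha).
have -> : 2 * (2 ^+ n * M ^+ 2)%:C = 2 ^+ n.+1 * M%:C ^+ 2.
  by rewrite rmorphM !rmorphXn rmorph_nat /= [2 ^+ n.+1]exprS; ring.
rewrite ler_pM2l ?exprn_gt0 ?ltr0Sn //.
by apply: le_trans (coords_bound Ha bound); rewrite lerD2l mid_le.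
Qed.

Lemma bin_ge3 n i : (2 <= n)%N -> (i < n)%N -> (3 <= 'C(n.+1, i.+1))%N.
Proof.
case: i => [|i] n2 lt_in; first by rewrite bin1.
rewrite binS; case: n n2 lt_in => // n _ lt_in.
apply: (@leq_add 1 2); first by rewrite bin_gt0.
exact: (bin_ge2 (Ordinal (lt_in : i < n)%N)).
Qed.

(* In degree [n.+1 >= 3] the weights [2 / 'C(n.+1, i.+1)] are [< 1]. *)
Lemma bombieri2_eq_mid0 n c (M : R) a : (2 <= n)%N -> coords n.+1 c a ->
  (forall x y, x ^+ 2 + y ^+ 2 = 1 -> `|hform n.+1 c x y| <= M) ->
  bombieri2 n.+1 c = 2 ^+ n * M ^+ 2 ->
  forall i, (i < n)%N -> a i.+1 = 0.
Proof.
move=> n2 Ha bound eqB i lt_in.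
have := coords_bound Ha bound.
(* Equality expresses [M ^ 2] by the weighted sum. Compared with [coords_bound], a sum of
   nonnegative terms is then at most 0, so each term vanishes. *)
have eqM : M%:C ^+ 2 = 4 * `|a 0%N| ^+ 2 +
    \sum_(i < n) 2 / 'C(n.+1, i.+1)%:R * `|a i.+1| ^+ 2.
  have p0 : (2 : C) ^+ n.+1 != 0 by rewrite expf_neq0 // pnatr_eq0.
  apply: (mulfI p0); rewrite -(bombieri2C Ha) eqB.
  by rewrite rmorphM !rmorphXn rmorph_nat /= [2 ^+ n.+1]exprS; ring.
rewrite eqM lerD2l -subr_ge0 -sumrB => le0.
have term_ge0 (j : 'I_n) : true ->
    0 <= `|a j.+1| ^+ 2 - 2 / 'C(n.+1, j.+1)%:R * `|a j.+1| ^+ 2.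
  by move=> _; rewrite subr_ge0 ler_piMl ?exprn_ge0 //; exact: bin_ratio_le1.
have sum0 : \sum_(j < n) (`|a j.+1| ^+ 2 - 2 / 'C(n.+1, j.+1)%:R * `|a j.+1| ^+ 2) = 0.
  apply/eqP; rewrite eq_le sumr_ge0 // andbT.
  by move: le0; rewrite sumrB -[X in 0 <= X]opprB oppr_ge0 -sumrB.
have /eqP : `|a i.+1| ^+ 2 - 2 / 'C(n.+1, i.+1)%:R * `|a i.+1| ^+ 2 = 0.
  by apply: (psumr_eq0P term_ge0 sum0 (i := Ordinal lt_in)).
rewrite /= -{1}[_ ^+ 2]mul1r -mulrBl mulf_eq0 sqrf_eq0 normr_eq0.
case/orP=> [|/eqP//]; have b3 := bin_ge3 n2 lt_in.
rewrite subr_eq0 eq_sym lt_eqF // ltr_pdivrMr ?mul1r ?ltr_nat //.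
by rewrite ltr0n (leq_trans _ b3).
Qed.

(** * Forms with only end coefficients: rotated Chebyshev forms *)

Lemma root_of_dir n (A : C) : exists2 u : C, `|u| = 1 & A = `|A| * u ^+ n.+1.
Proof.
have [->|A0] := eqVneq A 0; first by exists 1; rewrite ?normr1 // normr0 mul0r.
have rA : (n.+1.-root (A / `|A|)) ^+ n.+1 = A / `|A| by rewrite rootCK.
exists (n.+1.-root (A / `|A|)); last by rewrite rA mulrC divfK ?normr_eq0.
by apply: (@norm_root1 _ n.+1) => //; rewrite rA normf_div normr_id divff ?normr_eq0.
Qed.

Lemma cheb_pt d x y :
  (hform d (hcheb R d) x y)%:C = (pt x y ^+ d + (pt x y)^* ^+ d) / 2.
Proof.
rewrite hform_realC -/(pt x y) conj_pt -hform_cheb.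
by apply: eq_hform => k _; rewrite hcheb_map.
Qed.

Lemma cheb10 d : hform d (hcheb R d) 1 0 = 1.
Proof.
apply: (@complexI R); rewrite cheb_pt conj_pt /pt !rmorph0 mulr0 addr0 subr0.
by rewrite rmorph1 !expr1n; field.
Qed.

Lemma cheb_le1 d x y : x ^+ 2 + y ^+ 2 = 1 -> `|hform d (hcheb R d) x y| <= 1.
Proof.
move/eqP; rewrite -norm_pt1 => /eqP n1.
have: `|(hform d (hcheb R d) x y)%:C| <= 1.
  rewrite cheb_pt normf_div [`|2|]ger0_norm ?ler0n // ler_pdivrMr ?ltr0n // mul1r.
  by rewrite (le_trans (ler_normD _ _)) // !normrX norm_conjC n1 !expr1n.
by rewrite normc_def /= expr0n addr0 sqrtr_sqr -(rmorph1 (real_complex R)) lecR.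
Qed.

(** With [a_0 = r u^d], [r = |a_0|] and [|u| = 1], the form is [a_0 z^d] plus its conjugate, that is
    [2 r Re ((u z)^d)]; multiplication by [u] is the rotation. *)
Lemma rotation_of_ends n c a : coords n.+1 c a ->
  (forall i, (i < n)%N -> a i.+1 = 0) ->
  exists s al be, [/\ 0 <= s, al ^+ 2 + be ^+ 2 = 1 &
    forall x y, hform n.+1 c x y =
      s * hform n.+1 (hcheb R n.+1) (al * x - be * y) (be * x + al * y)].
Proof.
move=> Ha mid0; have [u u1 Du] := root_of_dir n (a 0%N).
pose r := complex.Re `|a 0%N|.
have Dr : `|a 0%N| = r%:C by rewrite /r normc_def.
exists (2 * r), (complex.Re u), (complex.Im u); split.
- by rewrite mulr_ge0 ?ler0n // -ler0c -Dr.
- by apply/eqP; rewrite -norm_pt1 -ptP u1.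
move=> x y; apply: (@complexI R); rewrite (coords_pt _ _ Ha) hform_ends //.
have -> : a n.+1 = (a 0%N)^* by case: Ha => _ <-; rewrite ?subn0.
rewrite Du Dr [RHS]rmorphM /= cheb_pt -ptM -ptP.
rewrite !rmorphM rmorphXn /= rmorph_nat !exprMn -Dr conj_normC.
by field.
Qed.

(** The isotropic coordinates can be written down: the ends are [s / 2 * u^d] and its conjugate, all
    others vanish. Their moduli do not depend on the rotation. *)
Lemma bombieri2_rotation n c s al be : al ^+ 2 + be ^+ 2 = 1 ->
  (forall x y, hform n.+1 c x y =
     s * hform n.+1 (hcheb R n.+1) (al * x - be * y) (be * x + al * y)) ->
  bombieri2 n.+1 c = 2 ^+ n * s ^+ 2.
Proof.
move=> /eqP; rewrite -norm_pt1 => /eqP n1 Hc; set u := pt al be in n1.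
have sJ : (s%:C)^* = s%:C by rewrite conj_Creal //; apply/complex_realP; exists s.
pose A : C := s%:C / 2 * u ^+ n.+1.
have AJ : A^* = s%:C / 2 * u^* ^+ n.+1.
  by rewrite /A rmorphM fmorph_div rmorphXn /= sJ conjC_nat.
pose a j : C := if j == 0%N then A else if j == n.+1 then A^* else 0.
have mid0 i : (i < n)%N -> a i.+1 = 0.
  by move=> lt_in; rewrite /a /= eqSS ltn_eqF.
have Ha : coords n.+1 c a.
  split=> [|j jn].
    apply: isotropic_coordsP => k.
    transitivity (hform n.+1 c 1 k%:R)%:C.
      by rewrite hform_realC rmorph1 rmorph_nat.
    rewrite Hc rmorphM /= cheb_pt -ptM -/u hform_ends // /a /= eqxx.
    have -> : 1 + 'i * k%:R = pt 1 k%:R by rewrite /pt rmorph1 rmorph_nat.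
    have -> : 1 - 'i * k%:R = (pt 1 k%:R)^*.
      by rewrite conj_pt rmorph1 rmorph_nat.
    by rewrite AJ /A rmorphM /= !exprMn; field.
  case: j jn => [|j] jn; first by rewrite subn0 /a /= eqxx.
  rewrite subSS /a /= eqSS; have [->|neq] := eqVneq j n.
    by rewrite subnn /= (conjCK A).
  have lt_jn : (j < n)%N by rewrite ltn_neqAle neq.
  rewrite conjC0 -(subnSK lt_jn) /= eqSS ltn_eqF //.
  by rewrite subnSK // leq_subr.
have two0 : (2 : C) != 0 by rewrite pnatr_eq0.
apply: (@complexI R); apply: (mulfI two0); rewrite (bombieri2C Ha) big1 => [|i _].
  rewrite addr0 /a /= /A normrM normrX n1 expr1n mulr1.
  have -> : `|s%:C / 2| ^+ 2 = s%:C ^+ 2 / 4.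
    by rewrite normCK fmorph_div /= sJ conjC_nat; field.
  by rewrite rmorphM !rmorphXn rmorph_nat [2 ^+ n.+1]exprS; field.
by rewrite mid0 // normr0 expr0n mulr0.
Qed.

(** * Degree two *)

Lemma bombieri2_sumsq c t :
  (forall x y, hform 2 c x y = t * (x ^+ 2 + y ^+ 2)) -> bombieri2 2 c = 2 * t ^+ 2.
Proof.
move=> Hc; pose b k := if k == 1%N then 0 else t.
have cb k : (k <= 2)%N -> c k = b k.
  apply: (@hform_inj R) => n; rewrite Hc /hform !big_ord_recr big_ord0 /= /b /=.
  by ring.
rewrite /bombieri2 !big_ord_recr big_ord0 /= !cb // /b /= bin0 bin1 binn.
by field.
Qed.

(** The middle weight is exactly 1, so equality reads [M^2 = 4 |a_0|^2 + a_1^2]. The form takes the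
    values [a_1 + 2 |a_0|] and [a_1 - 2 |a_0|] on the circle; bounding both squares by [M^2] forces
    the cross term [4 |a_0| a_1] to be both at most and at least 0. *)
Lemma bombieri2_eq_quadratic c (M : R) a : coords 2 c a ->
  (forall x y, x ^+ 2 + y ^+ 2 = 1 -> `|hform 2 c x y| <= M) ->
  bombieri2 2 c = 2 * M ^+ 2 -> a 0%N = 0 \/ a 1%N = 0.
Proof.
move=> Ha bound eqB.
have a1R : a 1%N \is Num.real by apply/CrealP; case: Ha => _ <-.
have a2 : a 2 = (a 0%N)^* by case: Ha => _ <-.
have eqM : M%:C ^+ 2 = 4 * `|a 0%N| ^+ 2 + `|a 1%N| ^+ 2.
  have p0 : (2 : C) ^+ 2 != 0 by rewrite expf_neq0 // pnatr_eq0.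
  apply: (mulfI p0).
  transitivity (2 * (bombieri2 2 c)%:C).
    by rewrite eqB rmorphM rmorphXn rmorph_nat /=; ring.
  by rewrite (bombieri2C Ha) big_ord_recl big_ord0 /= bin1; field.
have [u u1 Du] := root_of_dir 1 (a 0%N).
have val z : `|z| = 1 -> `|a 0%N * z ^+ 2 + a 1%N + (a 0%N * z ^+ 2)^*| ^+ 2 <= M%:C ^+ 2.
  move=> z1.
  have -> : a 0%N * z ^+ 2 + a 1%N + (a 0%N * z ^+ 2)^* = hform 2 a z z^*.
    rewrite /hform !big_ord_recr big_ord0 /= a2 rmorphM rmorphXn /=.
    have zz : z * z^* = 1 by rewrite -normCK z1 expr1n.
    by rewrite -[in LHS](mulr1 (a 1%N)) -zz; ring.
  rewrite [z]ptP -(coords_pt _ _ Ha) in z1 *.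
  have /bound le_M : complex.Re z ^+ 2 + complex.Im z ^+ 2 = 1.
    by apply/eqP; rewrite -norm_pt1 z1.
  have M0 : 0 <= M by apply: le_trans le_M.
  rewrite normc_def /= expr0n addr0 sqrtr_sqr -!rmorphXn lecR.
  by rewrite lerXn2r // nnegrE.
have uJ : u^* * u = 1 by rewrite mulrC -normCK u1 expr1n.
have plus : (2 * `|a 0%N| + a 1%N) ^+ 2 <= M%:C ^+ 2.
  have := val u^*; rewrite norm_conjC => /(_ u1).
  have -> : a 0%N * u^* ^+ 2 = `|a 0%N|.
    by rewrite {1}Du -mulrA -exprMn [u * _]mulrC uJ expr1n mulr1.
  rewrite conj_normC addrAC.
  have -> : `|a 0%N| + `|a 0%N| + a 1%N = 2 * `|a 0%N| + a 1%N by ring.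
  by rewrite real_normK // rpredD // rpredM ?realn ?normr_real.
have minus : (- 2 * `|a 0%N| + a 1%N) ^+ 2 <= M%:C ^+ 2.
  (* A quarter turn from the previous point changes the sign of [a_0 z^2]. *)
  have := val ('i * u^*); rewrite normrM normCi mul1r norm_conjC => /(_ u1).
  have -> : a 0%N * ('i * u^*) ^+ 2 = - `|a 0%N|.
    by rewrite exprMn sqrCi {1}Du mulN1r mulrN -mulrA -exprMn [u * _]mulrC uJ expr1n mulr1.
  rewrite rmorphN /= conj_normC addrAC.
  have -> : - `|a 0%N| - `|a 0%N| + a 1%N = - 2 * `|a 0%N| + a 1%N by ring.
  by rewrite real_normK // rpredD // rpredM ?rpredN ?realn ?normr_real.
move: plus minus; rewrite eqM (real_normK a1R).
rewrite -subr_ge0 => plus; rewrite -subr_ge0 => minus.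
have /eqP : `|a 0%N| * a 1%N = 0.
  apply/eqP; rewrite eq_le -oppr_ge0.
  rewrite -(pmulr_rge0 _ (ltr0n C 4)) -[X in _ && X](pmulr_rge0 _ (ltr0n C 4)).
  apply/andP; split; [move: plus | move: minus];
    by congr (0 <= _); ring.
by rewrite mulf_eq0 normr_eq0 => /orP[] /eqP; [left | right].
Qed.

(** Only [a_1 z w] is left, where [z w = x^2 + y^2] and [a_1] is real, being its own conjugate. *)
Lemma sumsq_of_mid c a : coords 2 c a -> a 0%N = 0 ->
  exists t, forall x y, hform 2 c x y = t * (x ^+ 2 + y ^+ 2).
Proof.
move=> Ha a0; have a2 : a 2 = 0 by case: Ha => _ /(_ 0%N isT) /= ->; rewrite a0 conjC0.
have a1R : a 1%N \is Num.real by apply/CrealP; case: Ha => _ <-.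
have [t Dt] := complex_realP _ a1R.
exists t => x y; apply: (@complexI R); rewrite (coords_pt _ _ Ha) rmorphM /=.
rewrite -norm_pt normCK -Dt /hform !big_ord_recr big_ord0 /= a0 a2.
by ring.
Qed.

End RealForms.

(** * The norms over the Stdlib reals *)

Local Notation R := Rdefinitions.R.

Section Bridge.
Implicit Types (p q : Defs.form) (x y m : R).

Lemma fevalE d p x y : feval d p x y = hform d p x y.
Proof.
rewrite /feval sum_f_R0E big_mkord; apply: eq_bigr => k _.
by rewrite !RealsE.
Qed.

Lemma binomialE d k : (k <= d)%N -> Binomial.C d k = 'C(d, k)%:R :> R.
Proof.
move=> kd; rewrite /Binomial.C !RealsE -(bin_fact kd) !natrM.
by field; rewrite !pnatr_eq0 -!lt0n !fact_gt0.
Qed.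

Lemma bombieriE d p : bombieri d p = Num.sqrt (bombieri2 d p).
Proof.
rewrite /bombieri RsqrtE sum_f_R0E big_mkord; congr Num.sqrt.
apply: eq_bigr => k _; have kd : (k <= d)%N by rewrite -ltnS.
by rewrite !RealsE binomialE.
Qed.

Lemma chebE d k : (k <= d)%N -> cheb d k = hcheb R d k.
Proof.
move=> kd; rewrite /cheb /hcheb.
have -> : Nat.even k = ~~ odd k.
  rewrite -Nat.negb_odd; congr negb.
  by elim: k {kd} => // k IH; rewrite Nat.odd_succ -Nat.negb_odd IH.
have -> : Nat.div2 k = k./2.
  have [j] := ubnP k; elim: j k {kd} => // j IH [|[|k]] //= ?.
  by rewrite IH // -ltnS ltnW.
by case: (odd k) => //=; rewrite !RealsE binomialE.
Qed.

Lemma feval_cheb d x y : feval d (cheb d) x y = hform d (hcheb R d) x y.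
Proof. by rewrite fevalE; apply: eq_hform => k; exact: chebE. Qed.

Lemma unif_normP d p m : IsUnifNorm d p m ->
  [/\ forall x y, x ^+ 2 + y ^+ 2 = 1 -> `|hform d p x y| <= m &
    exists x y, x ^+ 2 + y ^+ 2 = 1 /\ `|hform d p x y| = m].
Proof.
move=> [le_m [x [y [xy1 Dm]]]]; split=> [u v uv1|].
  by have := le_m u v; rewrite fevalE !RealsE => /(_ uv1)/RleP.
by exists x, y; move: xy1 Dm; rewrite fevalE !RealsE.
Qed.

Lemma unif_norm_ge0 d p m : IsUnifNorm d p m -> 0 <= m.
Proof. by move=> /unif_normP[_ [x [y [_ <-]]]]. Qed.

Lemma bombieri2_gt0 d p : form_nonzero d p -> 0 < bombieri2 d p.
Proof.
move=> [k [/ssrnat.leP kd pk]].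
have bin0 (j : 'I_d.+1) : 0 < 'C(d, j)%:R :> R.
  by rewrite ltr0n bin_gt0 -ltnS.
have ge0 (j : 'I_d.+1) : 0 <= p j ^+ 2 / 'C(d, j)%:R.
  by rewrite mulr_ge0 ?sqr_ge0 // invr_ge0 ltW.
rewrite /bombieri2 (bigD1 (Ordinal (kd : k < d.+1)%N)) //=.
apply: ltr_wpDr; first by rewrite sumr_ge0.
rewrite divr_gt0 ?(bin0 (Ordinal (kd : k < d.+1)%N)) //.
by rewrite exprn_even_gt0 //=; apply/eqP.
Qed.

(** * From ratios of norms to their squares *)

Lemma ratioE m (B : R) : 0 <= m -> 0 < B -> m / Num.sqrt B = Num.sqrt (m ^+ 2 / B).
Proof. by move=> m0 B0; rewrite sqrtrM ?sqr_ge0 // sqrtrV 1?ltW // sqrtr_sqr ger0_norm. Qed.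

Lemma ratio_geP n m (B : R) : 0 <= m -> 0 < B ->
  (1 / Num.sqrt (2 ^+ n) <= m / Num.sqrt B) = (B <= 2 ^+ n * m ^+ 2).
Proof.
move=> m0 B0; have P0 : 0 < 2 ^+ n :> R by rewrite exprn_gt0 // ltr0n.
rewrite !ratioE // expr1n ler_sqrt ?divr_ge0 ?sqr_ge0 ?(ltW B0) //.
by rewrite ler_pdivlMr // mulrAC ler_pdivrMr // mul1r mulrC.
Qed.

Lemma ratio_eqP n m (B : R) : 0 <= m -> 0 < B ->
  m / Num.sqrt B = 1 / Num.sqrt (2 ^+ n) <-> B = 2 ^+ n * m ^+ 2.
Proof.
move=> m0 B0; have P0 : 0 < 2 ^+ n :> R by rewrite exprn_gt0 // ltr0n.
have PN0 : (2 ^+ n : R) != 0 by rewrite gt_eqF.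
have BN0 : B != 0 by rewrite gt_eqF.
rewrite !ratioE // expr1n; split=> [/eqP|DB].
  rewrite eqr_sqrt ?divr_ge0 ?sqr_ge0 ?(ltW B0) ?(ltW P0) //.
  by rewrite eqr_div // mul1r => /eqP <-; rewrite mulrC.
have mN0 : m != 0.
  by apply: contraNneq BN0 => m00; rewrite DB m00 expr0n mulr0.
by rewrite DB; congr Num.sqrt; field; rewrite PN0 mN0.
Qed.

(** * The action of [CO(2)] on Chebyshev forms and on the sum of squares *)

Lemma orth2P a b c e : orth2 a b c e ->
  a ^+ 2 + c ^+ 2 = 1 /\ exists2 dl : R, dl ^+ 2 = 1 & b = - (dl * c) /\ e = dl * a.
Proof.
rewrite /orth2 !RealsE -!expr2 => -[ac1 [be1 abce0]]; split=> //.
(* The determinant: the second column is plus or minus the quarter turn of the first. Its square is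
   1 by Lagrange's identity. *)
exists (a * e - b * c).
  transitivity ((a ^+ 2 + c ^+ 2) * (b ^+ 2 + e ^+ 2) - (a * b + c * e) ^+ 2).
    by ring.
  by rewrite ac1 be1 abce0 expr0n subr0 mulr1.
split.
  rewrite -[LHS]mulr1 -ac1 -[RHS]subr0 -(mulr0 (- a)) -abce0; ring.
rewrite -[LHS]mulr1 -ac1 -[RHS]addr0 -(mulr0 c) -abce0; ring.
Qed.

(** A reflection differs from a rotation by the sign of the second coordinate, which a Chebyshev
    form does not see by [hform_chebN]. *)
Lemma pullback_rotation d p : CO2_pullback d p (cheb d) ->
  exists s al be : R, [/\ 0 <= s, al ^+ 2 + be ^+ 2 = 1 &
    forall x y, hform d p x y =
      s * hform d (hcheb R d) (al * x - be * y) (be * x + al * y)].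
Proof.
move=> [s [a [b [c [e [/RltP s0 [/orth2P[ac1 [dl dl1 [Db De]]] Hp]]]]]]].
exists s, a, (- c); split; [exact: ltW | by rewrite sqrrN | move=> x y].
rewrite -fevalE Hp feval_cheb !RealsE; congr (s * _).
have -> : a * x - - c * y = a * x + c * y by ring.
have /eqP := dl1; rewrite sqrf_eq1 Db De => /orP[] /eqP ->.
  by congr hform; ring.
by rewrite -hform_chebN; congr hform; ring.
Qed.

Lemma rotation_pullback d p (s al be : R) : 0 < s -> al ^+ 2 + be ^+ 2 = 1 ->
  (forall x y, hform d p x y =
     s * hform d (hcheb R d) (al * x - be * y) (be * x + al * y)) ->
  CO2_pullback d p (cheb d).
Proof.
move=> s0 ab1 Hp; exists s, al, be, (- be), al; split; first exact/RltP.
rewrite /orth2 !RealsE; split=> [|x y].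
  split; first by rewrite mulrNN -!expr2.
  by split; [rewrite -!expr2 addrC | ring].
by rewrite fevalE feval_cheb Hp !RealsE mulNr.
Qed.

Lemma unif_norm_rotation d p m (s al be : R) : IsUnifNorm d p m ->
  0 <= s -> al ^+ 2 + be ^+ 2 = 1 ->
  (forall x y, hform d p x y =
     s * hform d (hcheb R d) (al * x - be * y) (be * x + al * y)) ->
  m = s.
Proof.
move=> /unif_normP[bound [x [y [xy1 Dm]]]] s0 ab1 Hp.
apply/eqP; rewrite eq_le; apply/andP; split.
  rewrite -Dm Hp normrM ger0_norm // ler_piMr //; apply: cheb_le1.
  transitivity ((al ^+ 2 + be ^+ 2) * (x ^+ 2 + y ^+ 2)); first by ring.
  by rewrite ab1 xy1 mulr1.
(* The rotation sends [(al, - be)] to [(1, 0)], where the Chebyshev form attains its maximum 1. *)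
have := bound al (- be); rewrite sqrrN => /(_ ab1); rewrite Hp.
have -> : al * al - be * - be = 1 by rewrite -ab1; ring.
have -> : be * al + al * - be = 0 by ring.
by rewrite cheb10 mulr1 ger0_norm.
Qed.

Lemma bombieri2_pullback n p m : IsUnifNorm n.+1 p m ->
  CO2_pullback n.+1 p (cheb n.+1) -> bombieri2 n.+1 p = 2 ^+ n * m ^+ 2.
Proof.
move=> Hm /pullback_rotation[s [al [be [s0 ab1 Hp]]]].
by rewrite (unif_norm_rotation Hm s0 ab1 Hp) (bombieri2_rotation ab1 Hp).
Qed.

Lemma pullback_of_ends n p a : form_nonzero n.+1 p -> coords n.+1 p a ->
  (forall i, (i < n)%N -> a i.+1 = 0) -> CO2_pullback n.+1 p (cheb n.+1).
Proof.
move=> /bombieri2_gt0 B0 Ha /(rotation_of_ends Ha)[s [al [be [s0 ab1 Hp]]]].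
(* The scale is only known to be nonnegative; [s = 0] would make the Bombieri norm of a nonzero form
   vanish. *)
apply: (rotation_pullback _ ab1 Hp); rewrite lt_def s0 andbT.
by apply: contraTneq B0 => s00; rewrite (bombieri2_rotation ab1 Hp) s00 expr0n mulr0 ltxx.
Qed.

(** Orthogonal maps preserve [x^2 + y^2]. The parameter [s0] covers [sumsq] and [negsumsq] at
    once. *)
Lemma pullback_sumsq p q (s0 : R) :
  (forall x y, feval 2 q x y = s0 * (x ^+ 2 + y ^+ 2)) ->
  CO2_pullback 2 p q ->
  exists2 s : R, 0 < s & forall x y, hform 2 p x y = s * s0 * (x ^+ 2 + y ^+ 2).
Proof.
move=> Hq [s [a [b [c [e [/RltP s_gt0 [/orth2P[ac1 [dl dl1 [Db De]]] Hp]]]]]]].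
exists s => // x y; rewrite -fevalE Hp Hq !RealsE -mulrA; congr (s * (s0 * _)).
rewrite Db De.
transitivity ((a * x + c * y) ^+ 2 + dl ^+ 2 * (a * y - c * x) ^+ 2).
  by ring.
rewrite dl1; transitivity ((a ^+ 2 + c ^+ 2) * (x ^+ 2 + y ^+ 2)); first by ring.
by rewrite ac1 mul1r.
Qed.

Lemma sumsq_pullback p q (s s0 : R) : 0 < s ->
  (forall x y, feval 2 q x y = s0 * (x ^+ 2 + y ^+ 2)) ->
  (forall x y, hform 2 p x y = s * s0 * (x ^+ 2 + y ^+ 2)) -> CO2_pullback 2 p q.
Proof.
move=> s_gt0 Hq Hp; exists s, 1, 0, 0, 1; split; first exact/RltP.
rewrite /orth2 !RealsE; split=> [|x y].
  by split; [|split]; rewrite ?mul0r ?mulr0 ?mul1r ?addr0 ?add0r.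
by rewrite fevalE Hp Hq !RealsE; ring.
Qed.

Lemma feval_sumsq x y : feval 2 sumsq x y = 1 * (x ^+ 2 + y ^+ 2).
Proof. by rewrite fevalE /hform !big_ord_recr big_ord0 /= /sumsq ?R0E ?R1E; ring. Qed.

Lemma feval_negsumsq x y : feval 2 negsumsq x y = -1 * (x ^+ 2 + y ^+ 2).
Proof.
by rewrite fevalE /hform !big_ord_recr big_ord0 /= /negsumsq /sumsq !RealsE ?R0E ?R1E; ring.
Qed.

(** Identifies [diffsq] with the Chebyshev form of degree two, so that the results on rotations
    apply to it. *)
Lemma feval_diffsq x y : feval 2 diffsq x y = feval 2 (cheb 2) x y.
Proof.
rewrite feval_cheb fevalE; apply: eq_hform => -[|[|[|k]]] //= _; rewrite /diffsq /hcheb /=.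
- by rewrite bin0 mulr1.
- by rewrite binn mulr1.
Qed.

Lemma CO2_pullback_ext d p q q' : (forall x y, feval d q x y = feval d q' x y) ->
  CO2_pullback d p q -> CO2_pullback d p q'.
Proof.
move=> eq_q [s [a [b [c [e [s0 [orth Hp]]]]]]].
by exists s, a, b, c, e; split=> //; split=> // x y; rewrite Hp eq_q.
Qed.

Lemma unif_norm_sumsq p m (t : R) : IsUnifNorm 2 p m ->
  (forall x y, hform 2 p x y = t * (x ^+ 2 + y ^+ 2)) -> m = `|t|.
Proof. by move=> /unif_normP[_ [x [y [xy1 <-]]]] ->; rewrite xy1 mulr1. Qed.

(** * Equality cases by degree *)

Lemma quadratic_extremal p m : form_nonzero 2 p -> IsUnifNorm 2 p m ->
  bombieri2 2 p = 2 * m ^+ 2 <->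
  CO2_pullback 2 p sumsq \/ CO2_pullback 2 p negsumsq \/ CO2_pullback 2 p diffsq.
Proof.
move=> p0 Hm; have [bound _] := unif_normP Hm; split; last first.
  have sumsqP (q : Defs.form) (s0 : R) : s0 ^+ 2 = 1 ->
      (forall x y, feval 2 q x y = s0 * (x ^+ 2 + y ^+ 2)) ->
      CO2_pullback 2 p q -> bombieri2 2 p = 2 * m ^+ 2.
    move=> s01 Hq /(pullback_sumsq Hq)[s _ Hp].
    by rewrite (bombieri2_sumsq Hp) (unif_norm_sumsq Hm Hp) real_normK ?num_real.
  move=> [|[]].
  - exact: sumsqP (expr1n _ _) feval_sumsq.
  - by apply: sumsqP feval_negsumsq; rewrite sqrrN expr1n.
  - by move=> /(CO2_pullback_ext feval_diffsq)/(bombieri2_pullback Hm).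
have [a Ha] := coords_ex 2 p.
move=> /(bombieri2_eq_quadratic Ha bound)[a0|a1]; last first.
  right; right; apply: (@CO2_pullback_ext _ _ (cheb 2)).
    by move=> x y; rewrite feval_diffsq.
  by apply: pullback_of_ends p0 Ha _ => -[].
have [t Hp] := sumsq_of_mid Ha a0.
have t0 : t != 0.
  apply: contraTneq (bombieri2_gt0 p0) => t0.
  by rewrite (bombieri2_sumsq Hp) t0 expr0n mulr0 ltxx.
(* The group only scales by positive factors, so the sign of [t] decides between [sumsq] and
   [negsumsq]. *)
have [t_gt0|t_lt0|t00] := ltgtP 0 t; last by rewrite -t00 eqxx in t0.
  by left; apply: (sumsq_pullback t_gt0 feval_sumsq) => x y; rewrite mulr1.
right; left; apply: (@sumsq_pullback _ _ (- t) _ _ feval_negsumsq) => [|x y].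
  by rewrite oppr_gt0.
by rewrite mulrNN mulr1.
Qed.

(** In degree one there are no middle coefficients, so every nonzero form is a scaled rotation of
    the Chebyshev form. *)
Lemma extremal_linear p m : form_nonzero 1 p -> IsUnifNorm 1 p m ->
  bombieri2 1 p = m ^+ 2.
Proof.
move=> p0 Hm; have [a Ha] := coords_ex 1 p.
by rewrite (bombieri2_pullback Hm (pullback_of_ends p0 Ha _)) ?expr0 ?mul1r.
Qed.

Lemma extremal_higher n p m : (2 <= n)%N -> form_nonzero n.+1 p ->
  IsUnifNorm n.+1 p m ->
  bombieri2 n.+1 p = 2 ^+ n * m ^+ 2 <-> CO2_pullback n.+1 p (cheb n.+1).
Proof.
move=> n2 p0 Hm; split=> [eqB|]; last exact: bombieri2_pullback.
have [bound _] := unif_normP Hm; have [a Ha] := coords_ex n.+1 p.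
exact: pullback_of_ends p0 Ha (bombieri2_eq_mid0 n2 Ha bound eqB).
Qed.

Lemma cheb_nonzero d : form_nonzero d (cheb d).
Proof.
exists 0%N; split; first exact/ssrnat.leP.
by rewrite chebE // /hcheb /= bin0 mulr1; apply/eqP; rewrite oner_neq0.
Qed.

Lemma cheb_pullback d : CO2_pullback d (cheb d) (cheb d).
Proof.
apply: (@rotation_pullback _ _ 1 1 0) => [||x y].
- exact: ltr01.
- by rewrite expr1n expr0n addr0.
- by rewrite -fevalE feval_cheb !mul1r !mul0r subr0 add0r.
Qed.

Lemma extremal_ratioE n : extremal_ratio n = 1 / Num.sqrt (2 ^+ n) :> R.
Proof. by rewrite /extremal_ratio !RealsE. Qed.

(** * The assertions of the theorem, with the degree written [n.+1] *)

Lemma norm_ratio_ge n p m : form_nonzero n.+1 p -> IsUnifNorm n.+1 p m ->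
  Rle (extremal_ratio n) (m / bombieri n.+1 p).
Proof.
move=> p0 Hm; have [bound _] := unif_normP Hm.
apply/RleP; rewrite bombieriE extremal_ratioE.
by rewrite ratio_geP ?(unif_norm_ge0 Hm) ?bombieri2_gt0 // bombieri2_le.
Qed.

Lemma norm_ratio_eq n p m : form_nonzero n.+1 p -> IsUnifNorm n.+1 p m ->
  m / bombieri n.+1 p = extremal_ratio n <->
  bombieri2 n.+1 p = 2 ^+ n * m ^+ 2.
Proof.
move=> p0 Hm; rewrite bombieriE extremal_ratioE.
by apply: ratio_eqP; [exact: unif_norm_ge0 Hm | exact: bombieri2_gt0].
Qed.

Lemma cheb_ratio n m : IsUnifNorm n.+1 (cheb n.+1) m ->
  m / bombieri n.+1 (cheb n.+1) = extremal_ratio n.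
Proof.
move=> Hm; apply/(norm_ratio_eq (cheb_nonzero _) Hm).
exact: bombieri2_pullback Hm (cheb_pullback _).
Qed.

Lemma linear_ratio p m : form_nonzero 1 p -> IsUnifNorm 1 p m ->
  m / bombieri 1 p = extremal_ratio 0.
Proof.
move=> p0 Hm; apply/(norm_ratio_eq p0 Hm).
by rewrite (extremal_linear p0 Hm) expr0 mul1r.
Qed.

Lemma quadratic_ratio p m : form_nonzero 2 p -> IsUnifNorm 2 p m ->
  m / bombieri 2 p = extremal_ratio 1 <->
  CO2_pullback 2 p sumsq \/ CO2_pullback 2 p negsumsq \/ CO2_pullback 2 p diffsq.
Proof.
move=> p0 Hm; apply: iff_trans (norm_ratio_eq p0 Hm) _.
by rewrite expr1; exact: quadratic_extremal.
Qed.

Lemma higher_ratio n p m : (3 <= n.+1)%coq_nat -> form_nonzero n.+1 p ->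
  IsUnifNorm n.+1 p m ->
  m / bombieri n.+1 p = extremal_ratio n <->
  CO2_pullback n.+1 p (cheb n.+1).
Proof.
move=> /ssrnat.leP n2 p0 Hm; apply: iff_trans (norm_ratio_eq p0 Hm) _.
exact: extremal_higher.
Qed.

End Bridge.

End BinaryForms.

Theorem theorem1p1 (d : nat) (hd : (1 <= d)%nat) :
  (forall mC, IsUnifNorm d (cheb d) mC ->
     mC / bombieri d (cheb d) = 1 / sqrt (2 ^ (d - 1))) /\
  (forall (p : form) (m : R), form_nonzero d p -> IsUnifNorm d p m ->
     m / bombieri d p >= 1 / sqrt (2 ^ (d - 1))) /\
  (d = 1%nat -> forall (p : form) (m : R), form_nonzero d p -> IsUnifNorm d p m ->
     m / bombieri d p = 1 / sqrt (2 ^ (d - 1))) /\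
  (d = 2%nat -> forall (p : form) (m : R), form_nonzero d p -> IsUnifNorm d p m ->
     (m / bombieri d p = 1 / sqrt (2 ^ (d - 1)) <->
      CO2_pullback d p sumsq \/ CO2_pullback d p negsumsq \/ CO2_pullback d p diffsq)) /\
  ((3 <= d)%nat -> forall (p : form) (m : R), form_nonzero d p -> IsUnifNorm d p m ->
     (m / bombieri d p = 1 / sqrt (2 ^ (d - 1)) <-> CO2_pullback d p (cheb d))).
Proof.
  destruct d as [|n]; [lia|].
  replace (S n - 1)%nat with n by lia.
  split; [|split; [|split; [|split]]].
  - exact (@BinaryForms.cheb_ratio n).
  - intros p m hp hm; exact (Rle_ge _ _ (BinaryForms.norm_ratio_ge hp hm)).
  - intros [= ->]; exact BinaryForms.linear_ratio.
  - intros [= ->]; exact BinaryForms.quadratic_ratio.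
  - intros hn p m; exact (@BinaryForms.higher_ratio n p m hn).
Qed.
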